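(* Let $w:\mathbb R^+\times\mathbb R\to\mathbb R^n$ and $f:\mathbb R^n\to\mathbb R^n$ (smooth) define the system of conservation laws $\partial_t w+\partial_x f(w)=0$, where $w=(w_1,w_2)$ with $w_1\in\mathbb R^l$, $w_2\in\mathbb R^{n-l}$, and $f=(0,f_2)$ with $f_2\in\mathbb R^{n-l}$. Assume that $\eta(w)$ is a (smooth) function which is strictly convex with respect to $w_2$ at fixed $w_1$ and such that $\partial_t\eta(w)=0$ for smooth solutions, and that $\nabla_{w_1}f_2(w)=0$. Then the system is hyperbolic.
   Context: Hyperbolic means that for every state $w$ the Jacobian matrix $\nabla_w f(w)$ is diagonalizable with real eigenvalues. *)

(* Defs.v *)
From HB Require Import structures.
From mathcomp Require Import all_boot all_order all_algebra.
From mathcomp Require Import all_classical all_reals all_analysis.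
Set Implicit Arguments. Unset Strict Implicit. Unset Printing Implicit Defensive.
Import Order.TTheory GRing.Theory Num.Theory.
Import numFieldNormedType.Exports.
Local Open Scope ring_scope.

Section Defs.
Variable R : realType.

Definition basisv (n : nat) (j : 'I_n) : 'rV[R]_n := delta_mx 0 j.

Definition iter_derive (V W : normedModType R) (s : seq V) (f : V -> W) : V -> W :=
  foldr (fun v g => fun x => derive g x v) f s.

Definition smooth (V W : normedModType R) (f : V -> W) : Prop :=
  forall (s : seq V) (x : V), differentiable (iter_derive s f) x.

Definition jac (n p : nat) (f : 'rV[R]_n -> 'rV[R]_p) (w : 'rV[R]_n)
  : 'M[R]_(p, n) :=
  \matrix_(i < p, j < n) (derive f w (basisv j)) 0 i.

Definition gradient (n : nat) (eta : 'rV[R]_n -> R) (w : 'rV[R]_n) : 'rV[R]_n :=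
  \row_(j < n) derive eta w (basisv j).

Definition hessian (n : nat) (eta : 'rV[R]_n -> R) (w : 'rV[R]_n) : 'M[R]_n :=
  \matrix_(i < n, j < n)
     derive (fun x => derive eta x (basisv j)) w (basisv i).

Definition hessian2 (l m : nat) (eta : 'rV[R]_(l + m) -> R) (w : 'rV[R]_(l + m))
  : 'M[R]_m :=
  \matrix_(i < m, j < m) hessian eta w (rshift l i) (rshift l j).

(* eta strictly convex w.r.t. w2 at fixed w1 (read as: positive definite
   Hessian in the w2 variables) *)
Definition strictly_convex_w2 (l m : nat) (eta : 'rV[R]_(l + m) -> R) : Prop :=
  forall (w : 'rV[R]_(l + m)) (v : 'rV[R]_m), v != 0 ->
    0 < (v *m hessian2 eta w *m v^T) 0 0.

(* the system d_t w + d_x f(w) = 0 is hyperbolic: for every state w the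
   Jacobian is diagonalizable over R (i.e. with real eigenvalues) *)
Definition hyperbolic (n : nat) (f : 'rV[R]_n -> 'rV[R]_n) : Prop :=
  forall w : 'rV[R]_n, diagonalizable (jac f w).

End Defs.

Arguments basisv {R n}.
Arguments smooth {R V W}.
Arguments jac {R n p}.
Arguments gradient {R n}.
Arguments hessian {R n}.
Arguments hessian2 {R l m}.
Arguments strictly_convex_w2 {R l m}.
Arguments hyperbolic {R n}.

(* Main.v *)
Require Import Defs.
From HB Require Import structures.
From mathcomp Require Import all_boot all_order all_algebra.
From mathcomp Require Import all_classical all_reals all_analysis.
From mathcomp Require Import ring complex.
Import Order.TTheory GRing.Theory Num.Theory.
Import numFieldNormedType.Exports.
Set Implicit Arguments. Unset Strict Implicit. Unset Printing Implicit Defensive.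
Local Open Scope ring_scope.

(* The entropy symmetrizes the flux.  Write A = nabla_{w2} f2 and
   H = nabla^2_{w2} eta.  Differentiating the conservation identity
   nabla_{w2} eta . A = 0 along w2 gives H A = - sum_i d_i eta nabla^2 f2_i,
   which is symmetric by Schwarz's theorem.  As nabla_{w1} f2 = 0, the
   Jacobian of f = (0, f2) is diag(0, A), and P = diag(1, H) is symmetric
   positive definite with P J symmetric.  Writing P = S^* S, the matrix
   S J S^-1 is Hermitian, so J is diagonalizable with real eigenvalues. *)

Section SymmetrizableMatrices.
Local Open Scope sesquilinear_scope.
Variable R : rcfType.
Local Notation C := R[i].
Local Notation toC := (real_complex R).

Definition posdef n (H : 'M[R]_n) :=
  forall v : 'rV[R]_n, v != 0 -> 0 < (v *m H *m v^T) 0 0.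

Lemma mulmx_tr_gt0 n (v : 'rV[R]_n) : v != 0 -> 0 < (v *m v^T) 0 0.
Proof.
move=> v_neq0; have [j vj_neq0] : exists j, v 0 j != 0.
  apply/existsP; apply: contraNT v_neq0 => /existsPn v0.
  by apply/eqP/rowP => j; rewrite mxE; exact/eqP/negPn/v0.
rewrite mxE (bigD1 j) //= mxE ltr_pwDl //.
  by rewrite lt0r mulf_neq0 //= -expr2 sqr_ge0.
by apply: sumr_ge0 => i _; rewrite mxE -expr2 sqr_ge0.
Qed.

Lemma posdef1 n : posdef (1%:M : 'M[R]_n).
Proof. by move=> v; rewrite mulmx1; exact: mulmx_tr_gt0. Qed.

Lemma posdef_block_diag m n (A : 'M[R]_m) (B : 'M[R]_n) :
  posdef A -> posdef B -> posdef (block_mx A 0 0 B).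
Proof.
move=> posA posB v; rewrite -[v]hsubmxK mul_row_block tr_row_mx mul_row_col.
rewrite !mulmx0 addr0 add0r mxE => v_neq0.
have posdef_ge0 k (M : 'M[R]_k) (u : 'rV_k) : posdef M -> 0 <= (u *m M *m u^T) 0 0.
  move=> posM; case: (eqVneq u 0) => [->|u_neq0]; last exact/ltW/posM.
  by rewrite !mul0mx mxE.
case: (eqVneq (lsubmx v) 0) => [v1_eq0|/posA v1_gt0].
  rewrite ltr_wpDl ?posdef_ge0 // posB //.
  by apply: contraNneq v_neq0 => v2_eq0; rewrite v1_eq0 v2_eq0 row_mx0.
by rewrite ltr_pwDl ?posdef_ge0.
Qed.

Lemma posdef_eigenvalue_gt0 n (H : 'M[R]_n) r :
  posdef H -> eigenvalue H r -> 0 < r.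
Proof.
move=> posH /eigenvalueP [v vH v_neq0].
by have := posH v v_neq0; rewrite vH -scalemxAl mxE pmulr_lgt0 // mulmx_tr_gt0.
Qed.

Lemma conj_real_complex (x : R) : (toC x)^* = toC x.
Proof. by apply/conj_Creal/complex_realP; exists x. Qed.

Lemma map_trmxC m n (A : 'M[R]_(m, n)) : (map_mx toC A)^t* = (map_mx toC A)^T.
Proof. by apply/matrixP => i j; rewrite !mxE conj_real_complex. Qed.

Lemma row_unitmx_neq0 (F : fieldType) n (U : 'M[F]_n) i :
  U \in unitmx -> row i U != 0.
Proof.
move=> U_unit; apply: contraTneq isT => Ui0.
have : row i (U *m invmx U) = row i 1%:M by rewrite mulmxV.
rewrite row_mul Ui0 mul0mx row1 => /rowP/(_ i) /eqP.
by rewrite !mxE (eqxx i) /= eq_sym oner_eq0.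
Qed.

Lemma diagonalizable_real_spectrum n (A : 'M[R]_n) (P : 'M[C]_n) (d : 'rV[C]_n) :
  P \in unitmx -> d \is a realmx ->
  P *m map_mx toC A = diag_mx d *m P -> diagonalizable A.
Proof.
case: n => [|n] in A P d *; first by move=> *; rewrite thinmx0; exact: diagonalizable0.
move=> P_unit d_real PA; apply/diagonalizableP.
have AE : map_mx toC A = conjmx (invmx P) (diag_mx d).
  by rewrite conjVmx // -mulmxA -PA mulKmx.
pose rs := undup [seq complex.Re (d 0 i) | i <- enum 'I_n.+1].
exists rs; first exact: undup_uniq.
rewrite -(dvdp_map toC) -mxminpoly_map AE mxminpoly_uconj ?unitmx_inv //.
rewrite mxminpoly_diag map_prod_XsubC.
apply: uniq_roots_dvdp; last by rewrite uniq_rootsE undup_uniq.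
apply/allP => _ /[!mem_undup] /mapP [i _ ->].
rewrite -(big_map toC predT (fun y => 'X - y%:P)) root_prod_XsubC.
apply/mapP; exists (complex.Re (d 0 i)).
  by rewrite mem_undup; apply/mapP; exists i; rewrite ?mem_enum.
by rewrite RRe_real //; exact: (mxOverP d_real).
Qed.

Lemma similar_hermitian_diagonalizable n (A : 'M[R]_n) (S : 'M[C]_n) :
  S \in unitmx -> S *m map_mx toC A *m invmx S \is hermsymmx -> diagonalizable A.
Proof.
set B := _ *m invmx S => S_unit B_herm.
have := orthomx_spectralP (hermitian_normalmx B_herm).
set V := spectralmx B => BE.
have V_unit : V \in unitmx := spectral_unit B.
apply: (@diagonalizable_real_spectrum _ _ (V *m S) (spectral_diag B)).
- by rewrite unitmx_mul V_unit S_unit.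
- exact: hermitian_spectral_diag_real.
have SA : S *m map_mx toC A = B *m S by rewrite mulmxKV.
by rewrite -mulmxA SA mulmxA {1}BE !mulmxA mulmxV // mul1mx.
Qed.

Lemma posdef_factor n (H : 'M[R]_n) : H^T = H -> posdef H ->
  exists2 S : 'M[C]_n, S \in unitmx & S^t* *m S = map_mx toC H.
Proof.
move=> H_sym H_pos; set HC := map_mx toC H.
have HC_herm : HC \is hermsymmx.
  apply/is_hermitianmxP; rewrite expr0 scale1r map_trmxC.
  by apply/matrixP => i j; rewrite !mxE -[in LHS]H_sym mxE.
have := orthomx_spectralP (hermitian_normalmx HC_herm).
set U := spectralmx HC; set d := spectral_diag HC => HCE.
have U_unit : U \in unitmx := spectral_unit HC.
pose r i := complex.Re (d 0 i).
have dE i : d 0 i = toC (r i).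
  by rewrite /r RRe_real //; exact/(mxOverP (hermitian_spectral_diag_real HC_herm)).
have r_gt0 i : 0 < r i.
  apply: posdef_eigenvalue_gt0 H_pos _; rewrite -(eigenvalue_map toC).
  suff : eigenvalue HC (d 0 i) by rewrite dE.
  apply/eigenvalueP; exists (row i U); last exact: row_unitmx_neq0.
  rewrite -row_mul HCE !mulmxA mulmxV // mul1mx mul_diag_mx.
  by apply/rowP => j; rewrite !mxE.
(* HC = U^-1 diag(d) U with U unitary and d > 0, so S := sqrt(diag d) U works. *)
pose s := \row_i Num.sqrt (r i).
exists (map_mx toC (diag_mx s) *m U).
  rewrite unitmx_mul map_unitmx U_unit andbT unitmxE det_diag unitfE.
  by apply/prodf_neq0 => i _; rewrite mxE sqrtr_eq0 -ltNge r_gt0.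
have ss : map_mx toC (diag_mx s *m diag_mx s) = diag_mx d.
  rewrite mulmx_diag map_diag_mx; congr diag_mx; apply/rowP => j.
  by rewrite !mxE -expr2 sqr_sqrtr ?ltW // dE.
have sC : (map_mx toC (diag_mx s))^t* = map_mx toC (diag_mx s).
  by rewrite map_trmxC map_trmx tr_diag_mx.
rewrite trmx_mul map_mxM sC -invmx_unitary ?spectral_unitarymx //.
by rewrite !mulmxA -(mulmxA (invmx U)) -map_mxM ss HCE.
Qed.

Lemma symmetrizable_diagonalizable n (A H : 'M[R]_n) :
  H^T = H -> posdef H -> (H *m A)^T = H *m A -> diagonalizable A.
Proof.
move=> H_sym H_pos HA_sym; have [S S_unit SSE] := posdef_factor H_sym H_pos.
apply: (similar_hermitian_diagonalizable S_unit).
have AHE : (map_mx toC A)^T *m map_mx toC H = map_mx toC H *m map_mx toC A.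
  by rewrite map_trmx -!map_mxM -[in LHS]H_sym -trmx_mul HA_sym.
have StA : S^t* *m (S *m map_mx toC A) = (map_mx toC A)^T *m S^t* *m S.
  by rewrite mulmxA SSE -AHE -SSE mulmxA.
have SAE : S *m map_mx toC A = invmx (S^t*) *m ((map_mx toC A)^T *m S^t* *m S).
  by rewrite -StA mulKmx // map_unitmx unitmx_tr.
apply/is_hermitianmxP; rewrite expr0 scale1r !trmx_mul !map_mxM map_trmxC.
by rewrite trmx_inv map_invmx SAE !mulmxA mulmxK.
Qed.

End SymmetrizableMatrices.

Section SecondDifference.
Local Open Scope classical_set_scope.
Context {R : realType} {V : normedModType R}.
Implicit Types (g : V -> R) (x u v : V) (t : R).

Lemma is_derive_line g x u t : derivable g (x + t *: u) u ->
  is_derive t 1 (fun s => g (x + s *: u)) ('D_u g (x + t *: u)).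
Proof.
move=> dg.
have E : (fun h : R => h^-1 *: (((fun s => g (x + s *: u)) \o shift t) (h *: 1)
            - g (x + t *: u))) =
         (fun h : R => h^-1 *: ((g \o shift (x + t *: u)) (h *: u) - g (x + t *: u))).
  apply/funext => h /=; congr (_ *: (g _ - _)).
  by rewrite scalerDl -[h%:A]/(h * 1) mulr1 addrCA.
by split; rewrite /derivable /derive E.
Qed.

Lemma mean_value (phi dphi : R -> R) (a b : R) : a < b ->
  (forall t, is_derive t 1 phi (dphi t)) ->
  exists2 c, a < c < b & phi b - phi a = dphi c * (b - a).
Proof.
move=> ab phi'; have phi_cont t := differentiable_continuous
  ((derivable1_diffP phi t).1 (@ex_derive _ _ _ _ _ _ _ (phi' t))).
have [c] := MVT ab (fun t _ => phi' t) (continuous_subspaceT phi_cont).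
by rewrite in_itv; exists c.
Qed.

Definition second_difference g x u v t :=
  g (x + t *: u + t *: v) - g (x + t *: u) - g (x + t *: v) + g x.

Lemma second_differenceC g x u v t :
  second_difference g x u v t = second_difference g x v u t.
Proof. by rewrite /second_difference [x + t *: u + _]addrAC; ring. Qed.

Lemma second_difference_mean_value g x u v t : 0 < t ->
  (forall y, derivable g y u) -> (forall y, derivable ('D_u g) y v) ->
  exists a b, [/\ 0 < a < t, 0 < b < t &
    second_difference g x u v t = t ^+ 2 * 'D_v ('D_u g) (x + a *: u + b *: v)].
Proof.
move=> t_gt0 dgu dguv.
pose phi s := g (x + t *: v + s *: u) - g (x + s *: u).
pose dphi s := 'D_u g (x + t *: v + s *: u) - 'D_u g (x + s *: u).
have phi' (s : R) : is_derive s (1 : R) phi (dphi s).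
  exact: is_deriveB (is_derive_line (dgu _)) (is_derive_line (dgu _)).
have [a a_in phiE] := mean_value t_gt0 phi'.
pose psi s := 'D_u g (x + a *: u + s *: v).
have psi' (s : R) : is_derive s (1 : R) psi ('D_v ('D_u g) (x + a *: u + s *: v)).
  exact: is_derive_line.
have [b b_in psiE] := mean_value t_gt0 psi'.
exists a, b; split => //.
move: phiE psiE; rewrite /phi /dphi /psi !scale0r !addr0 !subr0 => phiE psiE.
have -> : second_difference g x u v t =
    g (x + t *: v + t *: u) - g (x + t *: u) - (g (x + t *: v) - g x).
  by rewrite /second_difference [x + t *: v + t *: u]addrAC; ring.
by rewrite phiE [x + t *: v + _]addrAC psiE; ring.
Qed.

Lemma second_difference_cvg g x u v :
  (forall y, derivable g y u) -> (forall y, derivable ('D_u g) y v) ->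
  {for x, continuous ('D_v ('D_u g))} ->
  (fun t => t ^- 2 * second_difference g x u v t) @ 0^'+ --> 'D_v ('D_u g) x.
Proof.
move=> dgu dguv /cvgrPdist_lt cont; apply/cvgrPdist_lt => e e_gt0.
have /nbhs_normP [d /= d_gt0 near_x] := cont e e_gt0.
have uv_gt0 : 0 < `|u| + `|v| + 1 by rewrite ltr_wpDl // addr_ge0.
near=> t.
have t_gt0 : 0 < t by near: t; exact: nbhs_right_gt.
have t_small : t * (`|u| + `|v|) < d.
  have : t < d / (`|u| + `|v| + 1) by near: t; apply: nbhs_right_lt; rewrite divr_gt0.
  rewrite ltr_pdivlMr // => /(le_lt_trans _); apply.
  by apply: ler_wpM2l; [exact: ltW | rewrite lerDl].
have [a [b [/andP[a_gt0 a_lt] /andP[b_gt0 b_lt] ->]]] :=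
  second_difference_mean_value x t_gt0 dgu dguv.
rewrite mulrA mulVf ?mul1r ?expf_neq0 ?gt_eqF //; apply: near_x => /=.
rewrite -addrA opprD addrA subrr add0r normrN.
apply: le_lt_trans (ler_normD _ _) (le_lt_trans _ t_small).
rewrite !normrZ !gtr0_norm // mulrDr.
by apply: lerD; rewrite ler_wpM2r // ltW.
Unshelve. all: by end_near.
Qed.

Lemma derive_comm g x u v :
  (forall y, derivable g y u) -> (forall y, derivable g y v) ->
  (forall y, derivable ('D_u g) y v) -> (forall y, derivable ('D_v g) y u) ->
  {for x, continuous ('D_v ('D_u g))} -> {for x, continuous ('D_u ('D_v g))} ->
  'D_v ('D_u g) x = 'D_u ('D_v g) x.
Proof.
move=> dgu dgv dguv dgvu cuv cvu.
have := second_difference_cvg dgv dgvu cvu.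
under eq_fun do rewrite second_differenceC.
exact: cvg_unique (second_difference_cvg dgu dguv cuv).
Qed.

End SecondDifference.

Section Smooth.
Context {R : realType}.

Lemma smooth_differentiable {V W : normedModType R} (g : V -> W) x :
  smooth g -> differentiable g x.
Proof. by move=> sg; exact: (sg [::] x). Qed.

Lemma smooth_derivable {V W : normedModType R} (g : V -> W) x v :
  smooth g -> derivable g x v.
Proof. by move=> sg; exact/diff_derivable/smooth_differentiable. Qed.

Lemma smooth_derive {V W : normedModType R} (g : V -> W) u :
  smooth g -> smooth ('D_u g).
Proof. by move=> sg s x; have := sg (rcons s u) x; rewrite /iter_derive -cats1 foldr_cat. Qed.

Lemma iter_derive_coord {V : normedModType R} p q (F : V -> 'M[R]_(p, q)) i j s :
  smooth F -> iter_derive s (fun x => F x i j) = fun x => iter_derive s F x i j.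
Proof.
move=> sF; elim: s => [//|v s IH] /=; rewrite IH; apply/funext => x.
by rewrite derive_mx ?mxE //; exact/diff_derivable/sF.
Qed.

Lemma smooth_coord {V : normedModType R} p q (F : V -> 'M[R]_(p, q)) i j :
  smooth F -> smooth (fun x => F x i j).
Proof.
move=> sF s x; rewrite iter_derive_coord //.
exact: differentiable_comp (sF s x) (differentiable_coord _ i j).
Qed.

Lemma smooth_derive_comm {V : normedModType R} (g : V -> R) u v x :
  smooth g -> 'D_v ('D_u g) x = 'D_u ('D_v g) x.
Proof.
move=> sg; have cg (h : V -> R) : smooth h -> {for x, continuous h}.
  by move=> sh; exact/differentiable_continuous/smooth_differentiable.
by apply: derive_comm => *; do ?[apply: smooth_derivable | apply: cg | apply: smooth_derive].
Qed.

Lemma jac_row0_mx n p q (F : 'rV[R]_n -> 'rV[R]_q) w :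
  (forall v, derivable F w v) ->
  jac (fun x => row_mx (0 : 'rV[R]_p) (F x)) w = col_mx 0 (jac F w).
Proof.
move=> dF; have dF0 v : derivable (fun x => row_mx (0 : 'rV[R]_p) (F x)) w v.
  apply/derivable_mxP => a b; case: (split_ordP b) => k ->.
    under eq_fun do rewrite row_mxEl mxE.
    exact: derivable_cst.
  under eq_fun do rewrite row_mxEr.
  exact: (derivable_mxP _ _ _).1 (dF v) a k.
apply/matrixP => i j; rewrite !mxE derive_mx // mxE.
case: (split_ordP i) => k ->; rewrite ?col_mxEu ?col_mxEd !mxE.
  under eq_fun do rewrite row_mxEl mxE.
  exact: derive_cst.
under eq_fun do rewrite row_mxEr.
by rewrite derive_mx // mxE.
Qed.

End Smooth.

Section PartialDerivatives.
Context {R : realType} {V : normedModType R} {m : nat} (e : 'I_m -> V).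

Definition partial_grad (eta : V -> R) x : 'rV[R]_m := \row_i 'D_(e i) eta x.

Definition partial_jac (g : 'I_m -> V -> R) x : 'M[R]_m :=
  \matrix_(i, j) 'D_(e j) (g i) x.

Definition partial_hess (eta : V -> R) x : 'M[R]_m :=
  \matrix_(i, j) 'D_(e i) ('D_(e j) eta) x.

Lemma partial_hess_sym eta x : smooth eta -> (partial_hess eta x)^T = partial_hess eta x.
Proof. by move=> seta; apply/matrixP => i j; rewrite !mxE smooth_derive_comm. Qed.

Lemma partial_hess_mul_jacE eta g x k j :
  smooth eta -> (forall i, smooth (g i)) ->
  (forall y, partial_grad eta y *m partial_jac g y = 0) ->
  (partial_hess eta x *m partial_jac g x) k j =
  - \sum_i 'D_(e i) eta x * 'D_(e k) ('D_(e j) (g i)) x.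
Proof.
move=> seta sg conserved.
have sum0 : \sum_i ('D_(e i) eta * 'D_(e j) (g i)) = cst 0.
  apply/funext => y; rewrite fct_sumE /=.
  transitivity ((partial_grad eta y *m partial_jac g y) 0 j); last by rewrite conserved mxE.
  by rewrite mxE; apply: eq_bigr => i _; rewrite !mxE.
have Dprod i : 'D_(e k) ('D_(e i) eta * 'D_(e j) (g i)) x =
    'D_(e i) eta x * 'D_(e k) ('D_(e j) (g i)) x +
    'D_(e j) (g i) x * 'D_(e k) ('D_(e i) eta) x.
  by rewrite deriveM; [by [] | exact/smooth_derivable/smooth_derive..].
have := derive_cst (0 : R) x (e k); rewrite -sum0 derive_sum => [/eqP|i]; last first.
  by apply: derivableM; exact/smooth_derivable/smooth_derive.
rewrite (eq_bigr _ (fun i _ => Dprod i)) big_split /= addrC addr_eq0 => /eqP <-.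
by rewrite mxE; apply: eq_bigr => i _; rewrite !mxE; exact: mulrC.
Qed.

Lemma partial_hess_mul_jac_sym eta g x :
  smooth eta -> (forall i, smooth (g i)) ->
  (forall y, partial_grad eta y *m partial_jac g y = 0) ->
  (partial_hess eta x *m partial_jac g x)^T = partial_hess eta x *m partial_jac g x.
Proof.
move=> seta sg conserved; apply/matrixP => k j; rewrite [LHS]mxE.
rewrite (partial_hess_mul_jacE x k j seta sg conserved).
rewrite (partial_hess_mul_jacE x j k seta sg conserved).
apply/eqP; rewrite eqr_opp; apply/eqP; apply: eq_bigr => i _.
by rewrite (smooth_derive_comm _ _ _ (sg i)).
Qed.
End PartialDerivatives.

Theorem lemma3p1 (R : realType) (l m : nat)
    (f2 : 'rV[R]_(l + m) -> 'rV[R]_m) (eta : 'rV[R]_(l + m) -> R) :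
  smooth f2 ->
  smooth eta ->
  strictly_convex_w2 eta ->
  (* d_t eta(w) = 0 along smooth solutions: grad eta(w) . nabla_w f(w) = 0,
     with f = (0, f2) *)
  (forall w : 'rV[R]_(l + m),
      gradient eta w *m jac (fun x => row_mx (0 : 'rV[R]_l) (f2 x)) w = 0) ->
  (* nabla_{w1} f2 = 0 *)
  (forall (w : 'rV[R]_(l + m)) (j : 'I_l), derive f2 w (basisv (lshift m j)) = 0) ->
  hyperbolic (fun x => row_mx (0 : 'rV[R]_l) (f2 x)).
Proof.
move=> sf2 seta convex conserved flux_w1 w.
pose e i : 'rV[R]_(l + m) := basisv (rshift l i).
pose g i x := f2 x 0 i.
have df2 x v : derivable f2 x v := smooth_derivable sf2.
have jacE x : jac (fun x => row_mx 0 (f2 x)) x = block_mx 0 0 0 (partial_jac e g x).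
  rewrite jac_row0_mx // -[block_mx _ _ _ _]/(col_mx (row_mx 0 0) (row_mx 0 _)) row_mx0.
  congr col_mx; apply/matrixP => i j; rewrite mxE.
  case: (split_ordP j) => k ->; first by rewrite row_mxEl flux_w1 !mxE.
  by rewrite row_mxEr derive_mx // !mxE.
have grad_conserved x : partial_grad e eta x *m partial_jac e g x = 0.
  have -> : partial_grad e eta x = rsubmx (gradient eta x) by apply/rowP => i; rewrite !mxE.
  have := conserved x; rewrite jacE -[gradient eta x]hsubmxK mul_row_block.
  by rewrite !mulmx0 !addr0 add0r hsubmxK -row_mx0 => /eq_row_mx [].
have hessE : hessian2 eta w = partial_hess e eta w by apply/matrixP => i j; rewrite !mxE.
have sg i : smooth (g i) := smooth_coord 0 i sf2.
apply: (@symmetrizable_diagonalizable _ _ _ (block_mx 1%:M 0 0 (hessian2 eta w))).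
- by rewrite tr_block_mx !trmx0 trmx1 hessE partial_hess_sym.
- apply: posdef_block_diag; [exact: posdef1 | exact: convex].
- rewrite jacE mulmx_block !mulmx0 !mul0mx !addr0 add0r hessE tr_block_mx !trmx0.
  by rewrite partial_hess_mul_jac_sym.
Qed.
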